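(* Let $H$ be a finite simple graph with $v(H)$ vertices and $e(H)$ edges such that $e(H)>v(H)/2$, and let $\epsilon\in(0,1)$. If $$\beta_2>\frac{-\frac12\left[\epsilon\log\epsilon+(1-\epsilon)\log(1-\epsilon)\right]}{\epsilon^{v(H)/2}-\epsilon^{e(H)}},$$ then the optimizing graphon of the variational problem $$\psi(\epsilon,\beta_2)=\sup\left\{\beta_2 t(H,h)-\frac12\iint_{[0,1]^2}I(h(x,y))\,dx\,dy\;:\;h\text{ a graphon},\ \iint_{[0,1]^2}h(x,y)\,dx\,dy=\epsilon\right\}$$ is non-uniform.
   Context: A graphon is a measurable function $h:[0,1]^2\to[0,1]$ with $h(x,y)=h(y,x)$. $I(x)=x\log x+(1-x)\log(1-x)$ on $[0,1]$, with $0\log 0=0$. For a finite simple graph $H$ with vertex set $\{1,\dots,v(H)\}$ and edge set $E(H)$, put $t(H,h)=\int_{[0,1]^{v(H)}}\prod_{\{i,j\}\in E(H)}h(x_i,x_j)\,dx_1\cdots dx_{v(H)}$. An optimizing graphon is a graphon with $\iint h=\epsilon$ attaining the supremum in the definition of $\psi(\epsilon,\beta_2)$. ''The optimizing graphon is non-uniform'' means that no optimizing graphon is a.e. constant (equivalently, the constant graphon $\epsilon$ does not attain the supremum). *)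

(* Defs.v *)
From HB Require Import structures.
From mathcomp Require Import all_boot all_order all_algebra.
From mathcomp Require Import all_classical all_reals all_analysis.

Set Implicit Arguments.
Unset Strict Implicit.
Unset Printing Implicit Defensive.

Import Order.TTheory GRing.Theory Num.Theory.
Import numFieldNormedType.Exports.

Local Open Scope classical_set_scope.
Local Open Scope ring_scope.

Section lebesgue_tuple.
Context {R : realType}.
Local Open Scope ereal_scope.

Local Notation T := (measurableTypeR R).
Local Notation mu := (@lebesgue_measure R).

Section cons.
Context {n : nat} (P : {sigma_finite_measure set (n.-tuple T) -> \bar R}).

Definition tuple_cons (p : T * n.-tuple T) : n.+1.-tuple T :=
  [the n.+1.-tuple T of p.1 :: p.2].

Lemma measurable_tuple_cons : measurable_fun [set: T * n.-tuple T] tuple_cons.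
Proof. by apply: measurable_cons. Qed.

Definition lebesgue_tuple_cons : set (n.+1.-tuple T) -> \bar R :=
  pushforward (mu \x P) tuple_cons.

HB.instance Definition _ := Measure.copy lebesgue_tuple_cons
  (measure_function_pushforward__canonical__measure_function_Measure (mu \x P) measurable_tuple_cons).

Let uncons (t : n.+1.-tuple T) : T * n.-tuple T :=
  (thead t, [tuple of behead t]).

Let measurable_uncons : measurable_fun [set: n.+1.-tuple T] uncons.
Proof.
apply/measurable_fun_pair => /=; last exact: measurable_behead.
exact: measurable_tnth.
Qed.

Let tuple_consK : cancel tuple_cons uncons.
Proof.
by move=> [x t]; rewrite /uncons /tuple_cons theadE; congr pair; apply: val_inj.
Qed.

Let sigma_finite_lebesgue_tuple_cons : sigma_finite setT lebesgue_tuple_cons.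
Proof.
have /sigma_finiteP[F [FT ndF Foo]] := sigma_finiteT mu.
have /sigma_finiteP[G [GT ndG Goo]] := sigma_finiteT P.
exists (fun k => uncons @^-1` (F k `*` G k)).
  rewrite -preimage_bigcup (_ : \bigcup_i _ = setT) ?preimage_setT//.
  apply/seteqP; split => // -[x t] _.
  have [i _ Fix] : (\bigcup_i F i) x by rewrite -FT.
  have [j _ Gjt] : (\bigcup_i G i) t by rewrite -GT.
  exists (maxn i j) => //; split => /=.
  - by move: x Fix; exact/subsetPset/ndF/leq_maxl.
  - by move: t Gjt; exact/subsetPset/ndG/leq_maxr.
move=> k; have [mF muF] := Foo k; have [mG PG] := Goo k; split.
  by rewrite -[X in measurable X]setTI; apply: measurable_uncons => //;
    exact: measurableX.
rewrite /lebesgue_tuple_cons /pushforward -comp_preimage.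
rewrite (_ : _ @^-1` _ = F k `*` G k).
  by rewrite product_measure1E// lte_mul_pinfty// ge0_fin_numE.
by apply/funext => p; rewrite /preimage/mkset/comp tuple_consK.
Qed.

HB.instance Definition _ := @Measure_isSigmaFinite.Build _ _ _
  lebesgue_tuple_cons sigma_finite_lebesgue_tuple_cons.

End cons.

Fixpoint lebesgue_tuple (n : nat) :
    {sigma_finite_measure set (n.-tuple T) -> \bar R} :=
  match n with
  | 0 => dirac [tuple]
  | n'.+1 => lebesgue_tuple_cons (lebesgue_tuple n')
  end.

Lemma lebesgue_tuple_box (n : nat) (A : 'I_n -> set T) :
  (forall i, measurable (A i)) ->
  lebesgue_tuple n [set t | forall i, A i (tnth t i)] = \prod_(i < n) mu (A i).
Proof.
elim: n A => [|n IH] A mA /=.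
  rewrite big_ord0 diracE mem_set//= => -[]//.
rewrite big_ord_recl -IH// -product_measure1E//; last first.
  rewrite (_ : [set t | _] = \bigcap_(i in setT) ((fun t => tnth t i) @^-1` (A (lift ord0 i)))).
    apply: fin_bigcap_measurable => // i _.
    rewrite -[X in measurable X]setTI; exact: measurable_tnth.
  by apply/seteqP; split => t /= h i //; [move=> _|]; exact: h.
rewrite /lebesgue_tuple_cons /pushforward; congr (_ _).
apply/seteqP; split => -[x t] /=.
  move=> h; split; first exact: (h ord0).
  by move=> i; have := h (lift ord0 i); rewrite tnthS.
move=> [h0 h] i; case: (unliftP ord0 i) => [j ->|->] //.
by rewrite tnthS; exact: h.
Qed.

End lebesgue_tuple.

(* Each edge {i, j} is encoded once, as the pair (i, j) with i < j. *)
Definition edges (n : nat) (H : rel 'I_n) : {set 'I_n * 'I_n} :=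
  [set p : 'I_n * 'I_n | (p.1 < p.2)%N && H p.1 p.2]%SET.

Section graphon.
Context {R : realType}.
Local Notation T := (measurableTypeR R).
Local Notation mu := (@lebesgue_measure R).
Implicit Types (h : T * T -> R) (eps beta : R).

Definition unit_square : set (T * T) := `[0, 1] `*` `[0, 1].

Definition unit_cube {n : nat} : set (n.-tuple T) :=
  [set x | forall i, tnth x i \in `[0, 1]].

(* Values of h outside the unit square are irrelevant. *)
Definition graphon h : Prop :=
  [/\ measurable_fun unit_square h,
      forall x, unit_square x -> 0 <= h x <= 1 &
      forall x y, unit_square (x, y) -> h (x, y) = h (y, x)].

Definition square_integral (f : T * T -> R) : R :=
  \int[(mu \x mu)%E]_(x in unit_square) f x.

Definition hom_density (n : nat) (H : rel 'I_n) h : R :=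
  \int[lebesgue_tuple n]_(x in unit_cube)
    \prod_(p in edges H) h (tnth x p.1, tnth x p.2).

(* [ln 0 = 0], which gives the convention 0 log 0 = 0. *)
Definition I_fun (x : R) : R := x * ln x + (1 - x) * ln (1 - x).

Definition energy (n : nat) (H : rel 'I_n) beta h : R :=
  beta * hom_density H h - 2^-1 * square_integral (I_fun \o h).

Definition admissible eps : set (T * T -> R) :=
  [set h | graphon h /\ square_integral h = eps].

Definition psi (n : nat) (H : rel 'I_n) eps beta : \bar R :=
  ereal_sup [set (energy H beta h)%:E | h in admissible eps].

Definition optimizing (n : nat) (H : rel 'I_n) eps beta h : Prop :=
  admissible eps h /\ (energy H beta h)%:E = psi H eps beta.

Definition ae_constant h : Prop :=
  exists c : R, {ae (mu \x mu)%E, forall x, unit_square x -> h x = c}.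

Definition non_uniform (n : nat) (H : rel 'I_n) eps beta : Prop :=
  forall h, optimizing H eps beta h -> ~ ae_constant h.

End graphon.

(* Main.v *)
(* An a.e. constant competitor has constant value [eps], hence energy
   [beta2 eps^e(H) - I(eps)/2]. The indicator of [[0, s]^2] with [s^2 = eps] has
   the same edge density, zero entropy, and homomorphism density at least
   [s^n = eps^(n/2)], since all [n] vertices may be mapped into [[0, s]]. The
   lower bound on [beta2] says exactly that the latter beats the former. *)
Require Import Defs.
From mathcomp Require Import all_boot all_order all_algebra.
From mathcomp Require Import all_classical all_reals all_analysis.
From mathcomp Require Import measurable_realfun lra.

Import Order.TTheory GRing.Theory Num.Theory.
Import numFieldNormedType.Exports.

Local Open Scope classical_set_scope.
Local Open Scope ring_scope.

(** * Transfer of null sets from the plane to tuples *)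

Section null_sets.
Context {R : realType}.
Local Open Scope ereal_scope.
Local Notation T := (measurableTypeR R).
Local Notation mu := (@lebesgue_measure R).

(** The set is a box with [A] in direction [i] and the whole line elsewhere; in the product of the
    side measures the factor 0 absorbs the infinite ones, as [0 * +oo = 0]. *)
Lemma lebesgue_tuple_tnth_null (n : nat) (i : 'I_n) (A : set T) :
  measurable A -> mu A = 0 -> lebesgue_tuple n [set t | A (tnth t i)] = 0.
Proof.
move=> mA A0; pose B k := if k == i then A else setT.
have -> : [set t : n.-tuple T | A (tnth t i)] = [set t | forall k, B k (tnth t k)].
  apply/seteqP; split => t /= => [Ati k|/(_ i)]; rewrite /B ?eqxx//.
  by case: eqP => // ->.
rewrite lebesgue_tuple_box => [|k]; last by rewrite /B; case: eqP.
by rewrite (bigD1 i)//= /B eqxx A0 mul0e.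
Qed.

Lemma measurable_tnth_pair (n : nat) (i j : 'I_n) :
  measurable_fun setT (fun t : n.-tuple T => (tnth t i, tnth t j)).
Proof. by apply/measurable_fun_pair => /=; exact: measurable_tnth. Qed.

(** Induction on [n], slicing along the first coordinate. This is what lets an a.e. property of [h]
    pass to each edge factor of the homomorphism density. *)
Lemma lebesgue_tuple_tnth_pair_null (n : nat) (i j : 'I_n) (N : set (T * T)) :
  (i < j)%N -> measurable N -> (mu \x mu) N = 0 ->
  lebesgue_tuple n [set t | N (tnth t i, tnth t j)] = 0.
Proof.
move=> + mN N0; elim: n i j => [|n IH] i j; first by case: i.
have mS m k l : measurable [set t : m.-tuple T | N (tnth t k, tnth t l)].
  by rewrite -[X in measurable X]setTI; exact: measurable_tnth_pair.
case: (unliftP ord0 j) => [{}j ->|-> //]; rewrite [lebesgue_tuple _ _]/=.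
rewrite /lebesgue_tuple_cons /pushforward /product_measure1.
case: (unliftP ord0 i) => [{}i ->|-> _].
  (* Neither index is the first one: every slice is the same kind of set in dimension [n], null by
     induction. *)
  rewrite /= /bump /= ltnS => ij.
  apply: integral0_eq => x _ /=.
  rewrite -[RHS](IH i j ij); congr (lebesgue_tuple n _).
  by apply/seteqP; split=> t; rewrite /xsection/= inE/= !tnthS.
pose S := tuple_cons @^-1` [set t : n.+1.-tuple T |
  N (tnth t ord0, tnth t (lift ord0 j))].
have mcS : measurable S.
  by rewrite -[S]setTI; apply: measurable_tuple_cons => //; exact: mS.
(* Here [i] is the first index. By definition of the product measure, the nonnegative function
   [mu \o xsection N] has integral 0, so it vanishes a.e. *)
have N_null : ae_eq mu setT (mu \o xsection N) (cst 0).
  apply/ae_eq_integral_abs => //; first exact: measurable_fun_xsection.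
  by under eq_integral do rewrite gee0_abs//=; exact: N0.
rewrite -[RHS](integral0 mu setT); apply: ae_eq_integral => //.
  exact: (@measurable_fun_xsection _ _ _ _ _ (lebesgue_tuple n) S mcS).
apply: filterS N_null => x /(_ I) /= Nx0 _.
(* For such [x], the slice only constrains coordinate [j] to the null set [xsection N x]. *)
rewrite -[RHS](@lebesgue_tuple_tnth_null n j (xsection N x) _ Nx0); last first.
  exact: measurable_xsection.
congr (lebesgue_tuple n _).
by apply/seteqP; split=> t; rewrite /xsection/= !inE/= tnth0 tnthS.
Qed.

Lemma ae_tnth_pair (n : nat) (i j : 'I_n) (P : T * T -> Prop) :
  (i < j)%N -> {ae (mu \x mu), forall x, P x} ->
  {ae (lebesgue_tuple n), forall t, P (tnth t i, tnth t j)}.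
Proof.
move=> ij [N [mN N0 PN]]; exists [set t | N (tnth t i, tnth t j)]; split.
- by rewrite -[X in measurable X]setTI; exact: measurable_tnth_pair.
- exact: lebesgue_tuple_tnth_pair_null.
- by move=> t; exact: PN.
Qed.

End null_sets.

(** * Measures of squares and cubes *)

Section energy.
Context {R : realType}.
Local Notation T := (measurableTypeR R).
Local Notation mu := (@lebesgue_measure R).

Lemma lebesgue_measure_segment (s : R) : 0 <= s -> mu `[0, s] = s%:E.
Proof.
rewrite le_eqVlt => /orP[/eqP <-|s0].
  by rewrite set_itv1 lebesgue_measure_set1.
by rewrite lebesgue_measure_itv/= lte_fin s0 sube0.
Qed.

Lemma lebesgue_measure_square (s : R) : 0 <= s ->
  (mu \x mu)%E (`[0, s] `*` `[0, s]) = (s ^+ 2)%:E.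
Proof.
by move=> s0; rewrite product_measure1E//= lebesgue_measure_segment.
Qed.

Lemma measurable_unit_square : measurable (@unit_square R).
Proof. exact: measurableX. Qed.

Lemma unit_square_measure1 : ((mu \x mu)%E (@unit_square R) = 1)%E.
Proof. by rewrite lebesgue_measure_square// expr1n. Qed.

Lemma lebesgue_tuple_cube (n : nat) (s : R) : 0 <= s ->
  lebesgue_tuple n [set t | forall i, tnth t i \in `[0, s]] = (s ^+ n)%:E.
Proof.
move=> s0; rewrite (@lebesgue_tuple_box _ _ (fun=> [set` `[0, s]])) // /=.
rewrite (eq_bigr (fun=> s%:E)) => [|i _]; last exact: lebesgue_measure_segment.
by rewrite prodEFin prodr_const card_ord.
Qed.

Lemma measurable_cube (n : nat) (s : R) :
  measurable [set t : n.-tuple T | forall i, tnth t i \in `[0, s]].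
Proof.
rewrite (_ : [set t | _] =
  \bigcap_(i in setT) ((fun t : n.-tuple T => tnth t i) @^-1` `[0, s])).
  apply: fin_bigcap_measurable => // i _.
  by rewrite -[X in measurable X]setTI; exact: measurable_tnth.
by apply/seteqP; split => [t h i _|t h i]; exact: h.
Qed.

Lemma measurable_unit_cube (n : nat) : measurable (@unit_cube R n).
Proof. exact: measurable_cube. Qed.

Lemma unit_cube_measure1 (n : nat) : (lebesgue_tuple n (@unit_cube R n) = 1)%E.
Proof. by have := @lebesgue_tuple_cube n 1 ler01; rewrite expr1n. Qed.

(** * Energy of almost everywhere constant graphons *)

Lemma Rintegral_ae_cst {d} {X : measurableType d}
    (nu : {measure set X -> \bar R}) (D : set X) (f : X -> R) (c : R) :
  measurable D -> nu D = 1%E -> measurable_fun D f ->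
  {ae nu, forall x, D x -> f x = c} -> \int[nu]_(x in D) f x = c.
Proof.
move=> mD nuD1 mf fc; transitivity (\int[nu]_(x in D) (cst c) x).
  rewrite /Rintegral; congr fine; apply: ae_eq_integral => //.
  - exact/measurable_EFinP.
  - by apply/measurable_EFinP; exact: measurable_cst.
  - by apply: filterS fc => x fxc Dx; rewrite /= fxc.
by rewrite Rintegral_cst// nuD1 mulr1.
Qed.

Lemma square_integral_ae_cst (f : T * T -> R) (c : R) :
  measurable_fun unit_square f ->
  {ae (mu \x mu)%E, forall x, unit_square x -> f x = c} ->
  square_integral f = c.
Proof.
apply: Rintegral_ae_cst; [exact: measurable_unit_square|].
exact: unit_square_measure1.
Qed.

Lemma unit_square_tnth (n : nat) (t : n.-tuple T) (i j : 'I_n) :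
  unit_cube t -> unit_square (tnth t i, tnth t j).
Proof. by move=> t01; split; exact: t01. Qed.

Lemma measurable_edge_prod (n : nat) (H : rel 'I_n) (h : T * T -> R) :
  measurable_fun unit_square h ->
  measurable_fun unit_cube
    (fun t : n.-tuple T => \prod_(p in edges H) h (tnth t p.1, tnth t p.2)).
Proof.
move=> mh; rewrite (_ : (fun t => _) = fun t : n.-tuple T =>
    \prod_(p <- enum (edges H)) h (tnth t p.1, tnth t p.2)); last first.
  by apply/funext => t; rewrite big_enum.
apply: measurable_prod => p _.
(* [h] is measurable only on the unit square, which contains every coordinate pair of a point of the
   cube. *)
apply: (@measurable_comp _ _ _ _ _ _ (@unit_square R) h _
  (fun t : n.-tuple T => (tnth t p.1, tnth t p.2))) => //.
- exact: measurable_unit_square.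
- by move=> _ [t t01 <-]; exact: unit_square_tnth.
- exact: measurable_funS (measurable_tnth_pair _ _ _).
Qed.

(** Each edge factor equals [c] off a null set of tuples, and the union of these finitely many null
    sets is null. *)
Lemma hom_density_ae_cst (n : nat) (H : rel 'I_n) (h : T * T -> R) (c : R) :
  measurable_fun unit_square h ->
  {ae (mu \x mu)%E, forall x, unit_square x -> h x = c} ->
  hom_density H h = c ^+ #|edges H|.
Proof.
move=> mh hc; apply: Rintegral_ae_cst => //.
- exact: measurable_unit_cube.
- exact: unit_cube_measure1.
- exact: measurable_edge_prod.
(* Membership in [edges H] sits under the a.e. quantifier so that [filter_forall] can range over the
   finite type of all pairs. *)
have hc' (p : 'I_n * 'I_n) : {ae lebesgue_tuple n, forall t, p \in edges H ->
    unit_square (tnth t p.1, tnth t p.2) -> h (tnth t p.1, tnth t p.2) = c}.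
  have [pH|pH] := boolP (p \in edges H); last exact: aeW.
  move: pH; rewrite inE => /andP[p12 _].
  by apply: filterS (ae_tnth_pair _ _ _ _ p12 hc) => t ht _.
apply: filterS
  (filter_forall (ae_filter_ringOfSetsType (lebesgue_tuple n)) hc') => t ht t01.
rewrite -prodr_const; apply: eq_bigr => p pH.
by exact: ht (unit_square_tnth _ _ _ _ t01).
Qed.

Lemma measurable_I_fun : measurable_fun setT (@I_fun R).
Proof.
have m1x : measurable_fun setT (fun x : R => 1 - x) by exact: measurable_funB.
apply: measurable_funD; apply: measurable_funM => //.
by apply: measurableT_comp => //; exact: measurable_ln.
Qed.

Lemma energy_ae_cst (n : nat) (H : rel 'I_n) (beta : R) (h : T * T -> R) (c : R) :
  measurable_fun unit_square h ->
  {ae (mu \x mu)%E, forall x, unit_square x -> h x = c} ->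
  energy H beta h = beta * c ^+ #|edges H| - 2^-1 * I_fun c.
Proof.
move=> mh hc; rewrite /energy (hom_density_ae_cst _ _ _ _ mh hc).
rewrite (@square_integral_ae_cst (I_fun \o h) (I_fun c))//.
- by apply: measurableT_comp => //; exact: measurable_I_fun.
- by apply: filterS hc => x hx x01; rewrite /= hx.
Qed.

(** * The competitor: a clique on [[0, s]] *)

Definition clique_graphon (s : R) : T * T -> R := \1_(`[0, s] `*` `[0, s]).

Lemma clique_graphonP (s : R) : graphon (clique_graphon s).
Proof.
split.
- by apply: measurable_indic; exact: measurableX.
- by move=> x _; rewrite /clique_graphon indicE lern1 ler0n leq_b1.
- move=> x y _; rewrite /clique_graphon !indicE; congr ((nat_of_bool _)%:R).
  by apply/idP/idP; rewrite !inE => -[].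
Qed.

Lemma square_integral_clique (s : R) :
  0 <= s <= 1 -> square_integral (clique_graphon s) = s ^+ 2.
Proof.
move=> /andP[s0 s1]; rewrite /square_integral /Rintegral integral_indic//.
- rewrite setIidl; first by rewrite /= lebesgue_measure_square.
  by apply: setSX; apply: subset_itvl; rewrite bnd_simp.
- exact: measurable_unit_square.
- exact: measurableX.
Qed.

Lemma I_fun0 : I_fun (0 : R) = 0.
Proof. by rewrite /I_fun mul0r subr0 ln1 mulr0 addr0. Qed.

Lemma I_fun1 : I_fun (1 : R) = 0.
Proof. by rewrite /I_fun subrr mul0r ln1 mulr0 addr0. Qed.

Lemma square_integral_I_clique (s : R) :
  square_integral (I_fun \o clique_graphon s) = 0.
Proof.
rewrite /square_integral (@eq_Rintegral _ _ _ _ _ (cst 0)) => [|x _].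
  by rewrite Rintegral_cst ?mul0r//; exact: measurable_unit_square.
by rewrite /= /clique_graphon indicE; case: (_ \in _); rewrite ?I_fun0 ?I_fun1.
Qed.

(* Only an inequality: isolated vertices of [H] are free to leave [[0, s]]. *)
Lemma hom_density_clique_ge (n : nat) (H : rel 'I_n) (s : R) :
  0 <= s <= 1 -> s ^+ n <= hom_density H (clique_graphon s).
Proof.
move=> /andP[s0 s1].
pose C := [set t : n.-tuple T | forall i, tnth t i \in `[0, s]].
have CU : C `<=` unit_cube.
  move=> t Ct i; have := Ct i; rewrite !in_itv/= => /andP[-> /le_trans]; exact.
have edge01 (t : n.-tuple T) :
    0 <= \prod_(p in edges H) clique_graphon s (tnth t p.1, tnth t p.2) <= 1.
  have c01 x : 0 <= clique_graphon s x <= 1.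
    by rewrite /clique_graphon indicE lern1 ler0n leq_b1.
  apply/andP; split.
    by apply: prodr_ge0 => p _; case/andP: (c01 (tnth t p.1, tnth t p.2)).
  by apply: prodr_ile1 => p _; exact: c01.
(* Writing [s ^+ n] as an integral over the cube reduces the claim to a pointwise comparison. *)
have -> : s ^+ n = \int[lebesgue_tuple n]_(t in unit_cube) \1_C t.
  rewrite /Rintegral integral_indic//.
  - rewrite setIidl//.
    exact: (congr1 fine (esym (lebesgue_tuple_cube n s s0))).
  - exact: measurable_unit_cube.
  - exact: measurable_cube.
have integrable01 (f : n.-tuple T -> R) : measurable_fun unit_cube f ->
    (forall t, 0 <= f t <= 1) ->
    (lebesgue_tuple n).-integrable unit_cube (EFin \o f).
  move=> mf f01; apply: measurable_bounded_integrable => //.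
  - exact: measurable_unit_cube.
  - by rewrite [ltLHS]unit_cube_measure1 ltry.
  - exists 1; split => // M M1 t _ /=; have /andP[f0 f1] := f01 t.
    by rewrite ger0_norm// (le_trans f1)// ltW.
apply: le_Rintegral.
- exact: measurable_unit_cube.
- apply: integrable01; first by apply: measurable_indic; exact: measurable_cube.
  by move=> t; rewrite indicE lern1 ler0n leq_b1.
- apply: integrable01 => //; apply: measurable_edge_prod.
  by have [] := clique_graphonP s.
(* Off [C] the indicator is 0; on [C] all edges have both ends in [[0, s]], so every factor is 1. *)
- move=> t _; rewrite [\1_C t]indicE; have [tC|tC] := boolP (t \in C); last first.
    by have /andP[] := edge01 t.
  rewrite big1// => p _; rewrite /clique_graphon indicE mem_set//.
  by move: tC; rewrite inE => tC; split; exact: tC.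
Qed.

End energy.

(** * Comparison of the two energies *)

Theorem proposition8 (R : realType) (n : nat) (H : rel 'I_n)
    (H_sym : symmetric H) (H_irr : irreflexive H)
    (H_edges : (#|edges H|%:R : R) > n%:R / 2)
    (eps beta2 : R) (eps_gt0 : 0 < eps) (eps_lt1 : eps < 1)
    (beta2_gt : beta2 >
       (- (1 / 2) * (eps * ln eps + (1 - eps) * ln (1 - eps)))
       / (eps `^ (n%:R / 2) - eps ^+ #|edges H|)) :
  non_uniform H eps beta2.
Proof.
move=> h [[[mh _ _] h_eps] h_opt] [c hc].
have c_eps : c = eps by rewrite -h_eps (square_integral_ae_cst _ _ mh hc).
subst c.
pose s := Num.sqrt eps.
have s01 : 0 <= s <= 1 by rewrite sqrtr_ge0 -sqrtr1 ler_sqrt// ltW.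
have sn : s ^+ n = eps `^ (n%:R / 2).
  by rewrite mulrC powRrM powR12_sqrt 1?ltW// powR_mulrn// sqrtr_ge0.
(* Since [ln eps < 0], the larger exponent, [#|edges H|] by [H_edges], gives the smaller power. *)
have gap_gt0 : 0 < eps `^ (n%:R / 2) - eps ^+ #|edges H|.
  rewrite subr_gt0 -powR_mulrn 1?ltW// /powR gt_eqF// ltr_expR.
  by rewrite ltr_nM2r// ln_lt0// eps_gt0.
(* This makes the lower bound on [beta2] nonnegative; [beta2 > 0] is needed to scale the density
   inequality. *)
have neg_I_ge0 : 0 <= - (1 / 2) * I_fun eps.
  have xlnx_le0 (x : R) : 0 < x < 1 -> x * ln x <= 0.
    by move=> x01; rewrite mulr_ge0_le0 ?ltW ?ln_lt0//; case/andP: x01.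
  have /xlnx_le0 := (introT andP (conj eps_gt0 eps_lt1)).
  have /xlnx_le0 : 0 < 1 - eps < 1 by apply/andP; split; lra.
  by rewrite /I_fun; lra.
have beta2_gt0 : 0 < beta2.
  by apply: le_lt_trans beta2_gt; apply: divr_ge0 => //; exact: ltW.
(* With the positive denominator cleared, it remains to derive the reverse inequality from the
   optimality of [h]. *)
move: beta2_gt; rewrite ltr_pdivrMr// -/(I_fun eps) ltNge => /negP; apply.
have : ((energy H beta2 (clique_graphon s))%:E <= (energy H beta2 h)%:E)%E.
  rewrite h_opt; apply: ereal_sup_ubound; exists (clique_graphon s) => //.
  split; first exact: clique_graphonP.
  by rewrite square_integral_clique// sqr_sqrtr// ltW.
rewrite lee_fin (energy_ae_cst _ _ _ _ _ mh hc) /energy square_integral_I_clique.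
rewrite mulr0 subr0 => energy_le.
have : beta2 * eps `^ (n%:R / 2) <= beta2 * hom_density H (clique_graphon s).
  by rewrite ler_pM2l// -sn hom_density_clique_ge.
lra.
Qed.
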